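(* Let $n_1,n_2,n_3$ be integers with $1\le n_1\le n_2\le n_3$. Then $$\mathrm{DOM}(K_{n_1,n_2,n_3})=\begin{cases} n_3, & \text{if } n_3\ge 3,\\ 3, & \text{if } n_1=n_2=n_3=2,\\ 2, & \text{otherwise.}\end{cases}$$
   Context: $K_{n_1,n_2,n_3}$ is the complete tripartite graph: its vertex set is partitioned into independent sets $A_1,A_2,A_3$ with $|A_i|=n_i$, and every vertex of $A_i$ is adjacent to every vertex of $A_j$ for $i\ne j$. An orientation of a graph $G$ is a digraph obtained by directing every edge of $G$ in exactly one of its two possible directions. In a digraph $D$ with vertex set $V(D)$ and arc set $A(D)$, a vertex $u$ dominates $v$ if $(u,v)\in A(D)$; a set $S\subseteq V(D)$ is a dominating set if every vertex of $V(D)\setminus S$ is dominated by some vertex of $S$; $\gamma(D)$ is the smallest cardinality of a dominating set of $D$. The orientable domination number of a graph $G$ is $\mathrm{DOM}(G)=\max\{\gamma(D): D \text{ is an orientation of } G\}$. *)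

(* Defs.v *)
From mathcomp Require Import all_boot.
Set Implicit Arguments.
Unset Strict Implicit.
Unset Printing Implicit Defensive.

(* A digraph on the finite vertex type V is given by its arc set
   D : {set V * V}; a simple graph by its (symmetric, irreflexive)
   adjacency relation. *)

Section Domination.
Variable V : finType.
Implicit Types (D : {set V * V}) (S : {set V}) (u v : V).

Definition dominates D u v : bool := (u, v) \in D.

Definition dominating D S : bool :=
  [forall v in ~: S, exists u in S, dominates D u v].

(* The default [set: V] of the arg min is always dominating (see
   dominating_setT), so this is a genuine minimum. *)
Definition gamma D : nat :=
  #|[arg min_(S < [set: V] | dominating D S) #|S|]|.

Lemma dominating_setT D : dominating D [set: V].
Proof. by apply/forallP => v; rewrite !inE. Qed.

Variable e : rel V.

Definition orientation D : bool :=
  [forall u, forall v,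
     if e u v then ((u, v) \in D) (+) ((v, u) \in D) else (u, v) \notin D].

Definition DOM : nat := \max_(D : {set V * V} | orientation D) gamma D.

End Domination.

Definition tripartite_vertex (n1 n2 n3 : nat) : finType :=
  ('I_n1 + 'I_n2 + 'I_n3)%type.

Definition part (n1 n2 n3 : nat) (v : tripartite_vertex n1 n2 n3) : 'I_3 :=
  match v with
  | inl (inl _) => inord 0
  | inl (inr _) => inord 1
  | inr _ => inord 2
  end.

Definition complete_tripartite (n1 n2 n3 : nat) :
    rel (tripartite_vertex n1 n2 n3) :=
  fun u v => part u != part v.
Arguments complete_tripartite : clear implicits.

Lemma complete_tripartite_sym n1 n2 n3 :
  symmetric (complete_tripartite n1 n2 n3).
Proof. by move=> u v; rewrite /complete_tripartite eq_sym. Qed.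

Lemma complete_tripartite_irr n1 n2 n3 :
  irreflexive (complete_tripartite n1 n2 n3).
Proof. by move=> u; rewrite /complete_tripartite eqxx. Qed.

(* Main.v *)
Require Import Defs.
From mathcomp Require Import all_boot zify.

(** Upper bound.  In an orientation of a complete tripartite graph a part [A]
    fails to dominate only if some vertex outside [A] dominates all of [A].
    Suppose this happens for every part, and let [w i] be a vertex dominating
    the whole part [i].  Since an edge is directed only one way, the three
    vertices [w i] must lie in three different parts
    ([dominator_part_inj]), and then the set [{w 0, w 1, w 2}] dominates.  So some
    dominating set is a part or has at most three vertices
    ([gamma_le_maxn3]).  If some part is a singleton, its only vertex is
    one of the [w j]; the vertex [w i] whose task is to dominate that
    singleton can then be dropped, and two vertices suffice
    ([gamma_le_maxn2]).

    Lower bound.  Directing all edges from later parts to earlier ones turns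
    the last part into a set of sources, which every dominating set contains
    ([DOM_ge_last]).  This gives [n3].  The two cases in which [n3] is too small,
    [K_{1,1,1}] and [K_{2,2,2}], are settled by the cyclic orientation, in which
    part [i] dominates part [i + 1]: a dominating set that misses a part must
    meet the preceding part and contain the whole following part
    ([cyclic_dominating_card]). *)

Set Implicit Arguments.
Unset Strict Implicit.
Unset Printing Implicit Defensive.

(** * The domination number as a minimum *)

Section Gamma.
Variables (V : finType) (D : {set V * V}).

Lemma gamma_le_card (S : {set V}) : dominating D S -> gamma D <= #|S|.
Proof.
move=> domS; rewrite /gamma; case: arg_minnP; first exact: dominating_setT.
by move=> T _; apply.
Qed.

Lemma gamma_geP k :
  (forall S : {set V}, dominating D S -> k <= #|S|) -> k <= gamma D.
Proof.
move=> leS; rewrite /gamma; case: arg_minnP; first exact: dominating_setT.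
by move=> S domS _; apply: leS.
Qed.

Lemma dominatingP (S : {set V}) :
  reflect (forall v, v \notin S -> exists2 u, u \in S & (u, v) \in D)
          (dominating D S).
Proof.
apply: (iffP forallP) => domS v.
  move=> vS; have := domS v; rewrite inE vS => /existsP[u /andP[uS uv]].
  by exists u.
apply/implyP; rewrite inE => /domS[u uS uv].
by apply/existsP; exists u; rewrite uS.
Qed.

End Gamma.

(** * Vertex sets split into three parts *)

(** The vertices are split into parts by an arbitrary map to three colours, so
    that the arguments are symmetric in the three parts. *)
Section ThreeParts.
Variables (V : finType) (col : V -> 'I_3).

Definition multipartite : rel V := fun u v => col u != col v.

Definition part_set (i : 'I_3) : {set V} := [set v | col v == i].

Lemma in_part_set i v : (v \in part_set i) = (col v == i).
Proof. by rewrite inE. Qed.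

Lemma card_part_set (T : finType) (f : T -> V) i :
  injective f -> (forall x, col (f x) = i) ->
  (forall v, col v = i -> exists x, v = f x) -> #|part_set i| = #|T|.
Proof.
move=> f_inj col_f f_onto; rewrite -(card_imset _ f_inj); apply: eq_card => v.
rewrite in_part_set; apply/eqP/imsetP => [/f_onto[x ->] | [x _ ->] //].
by exists x.
Qed.

(** ** Upper bounds for an arbitrary orientation *)

Section UpperBound.
Variable D : {set V * V}.
Hypothesis orD : orientation multipartite D.

Lemma orientation_arc u v :
  col u != col v -> ((u, v) \in D) (+) ((v, u) \in D).
Proof.
move=> uv; have /forallP/(_ u)/forallP/(_ v) := orD.
by rewrite /multipartite uv.
Qed.

Lemma part_not_dominating i :
  ~~ dominating D (part_set i) ->
  exists2 v, col v != i & forall u, col u = i -> (v, u) \in D.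
Proof.
case/forallPn => v; rewrite negb_imply !inE => /andP[vi /existsPn noarc].
exists v => // u ui; have := noarc u; rewrite in_part_set ui eqxx /= => nuv.
have: col v != col u by rewrite ui.
by move/orientation_arc; rewrite (negbTE nuv : (u, v) \in D = false) addbF.
Qed.

Section Dominators.
Variable w : 'I_3 -> V.
Hypothesis w_out : forall i, col (w i) != i.
Hypothesis w_dom : forall i u, col u = i -> (w i, u) \in D.

Lemma dominator_part_not_swapped i : col (w (col (w i))) != i.
Proof.
apply/eqP => wwi; set j := col (w i) in wwi.
have := orientation_arc (u := w i) (v := w j).
by rewrite wwi w_out !w_dom // => /(_ isT).
Qed.

(** If [w i] and [w j] were both in a part [k], then [w k] could be neither in
    [k] nor, as arcs are not reversed, in [i] or [j]: a fourth part would
    be needed. *)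
Lemma dominator_part_inj : injective (fun i => col (w i)).
Proof.
move=> i j eq_ij; apply/eqP/negPn/negP => nij.
have nki := w_out i; have nkj := w_out j.
have nwi := dominator_part_not_swapped i; have nwj := dominator_part_not_swapped j.
move: nkj nwj; rewrite -eq_ij => nkj nwj; have nwk := w_out (col (w i)).
set s := [:: col (w (col (w i))); col (w i); j; i].
have uniq_s : uniq s.
  by rewrite /= !inE !negb_or nwk nwj nwi nkj nki eq_sym nij.
by have := max_card (mem s); rewrite (card_uniqP uniq_s) card_ord.
Qed.

Lemma dominators_dominating : dominating D [set w i | i : 'I_3].
Proof.
by apply/dominatingP => v _; exists (w (col v)); [apply: imset_f | apply: w_dom].
Qed.

Lemma dominators_dominating_singleton i :
  #|part_set i| = 1 -> dominating D [set w j | j in [set~ i]].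
Proof.
move/eqP/cards1P => [a Ai]; apply/dominatingP => v vS.
have [vi | nvi] := eqVneq (col v) i; last first.
  by exists (w (col v)); [apply: imset_f; rewrite !inE | apply: w_dom].
(* The only vertex of part [i] is itself some [w j], hence already chosen. *)
have /codomP[j ji] := injF_onto dominator_part_inj i.
have ina u : col u = i -> u = a.
  by move=> ui; apply/set1P; rewrite -Ai in_part_set ui.
case/negP: vS; rewrite (ina v vi) -(ina (w j) (esym ji)).
by apply: imset_f; rewrite !inE ji eq_sym w_out.
Qed.

End Dominators.

Lemma part_dominating_or_dominators :
  (exists i, dominating D (part_set i)) \/
  (exists2 w : 'I_3 -> V, forall i, col (w i) != i
     & forall i u, col u = i -> (w i, u) \in D).
Proof.
have [/existsP ? | /existsPn nodom] :=
  boolP [exists i, dominating D (part_set i)]; [by left | right].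
have dominator i : exists v, (col v != i) && [forall (u | col u == i), (v, u) \in D].
  have [v vi vu] := part_not_dominating (nodom i).
  by exists v; rewrite vi; apply/forall_inP => u /eqP /vu.
exists (fun i => xchoose (dominator i)) => i; last move=> u ui.
  by have /andP[] := xchooseP (dominator i).
have /andP[_ /forall_inP dom_i] := xchooseP (dominator i).
by apply: dom_i; apply/eqP.
Qed.

Lemma gamma_le_maxn3 m :
  (forall i, #|part_set i| <= m) -> gamma D <= maxn m 3.
Proof.
move=> le_m; have [[i domi] | [w w_out w_dom]] := part_dominating_or_dominators.
  by rewrite leq_max (leq_trans (gamma_le_card domi)).
apply: leq_trans (gamma_le_card (dominators_dominating w_dom)) _.
apply: leq_trans (leq_maxr _ _).
by rewrite (leq_trans (leq_imset_card _ _)) ?card_ord.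
Qed.

Lemma gamma_le_maxn2 m i :
  (forall i, #|part_set i| <= m) -> #|part_set i| = 1 -> gamma D <= maxn m 2.
Proof.
move=> le_m i1; have [[j domj] | [w w_out w_dom]] := part_dominating_or_dominators.
  by rewrite leq_max (leq_trans (gamma_le_card domj)).
apply: leq_trans (gamma_le_card (dominators_dominating_singleton w_out w_dom i1)) _.
apply: leq_trans (leq_maxr _ _).
by rewrite (leq_trans (leq_imset_card _ _)) ?cardsC1 ?card_ord.
Qed.

End UpperBound.

(** ** Orientations with large domination number *)

Lemma DOM_le k :
  (forall D, orientation multipartite D -> gamma D <= k) ->
  DOM multipartite <= k.
Proof. by move=> le_k; apply/bigmax_leqP. Qed.

Lemma DOM_ge k D :
  orientation multipartite D ->
  (forall S : {set V}, dominating D S -> k <= #|S|) -> k <= DOM multipartite.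
Proof.
move=> orD /gamma_geP leD; apply: leq_trans leD _.
exact: (leq_bigmax_cond (F := @gamma V)).
Qed.

Definition decreasing_orientation : {set V * V} :=
  [set a | col a.2 < col a.1].

Lemma decreasing_orientationP : orientation multipartite decreasing_orientation.
Proof.
apply/forallP => u; apply/forallP => v; rewrite /multipartite !inE /= -val_eqE /=.
by case: ltngtP.
Qed.

Lemma DOM_ge_last : #|part_set ord_max| <= DOM multipartite.
Proof.
apply: (DOM_ge decreasing_orientationP) => S /dominatingP domS.
apply/subset_leq_card/subsetP => v; rewrite in_part_set => /eqP vmax.
apply/negPn/negP => /domS[u _]; rewrite inE /= vmax /=.
by rewrite ltnNge -ltnS ltn_ord.
Qed.

Definition cyclic_orientation : {set V * V} :=
  [set a | col a.2 == ordS (col a.1)].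

Lemma cyclic_orientationP : orientation multipartite cyclic_orientation.
Proof.
apply/forallP => u; apply/forallP => v; rewrite /multipartite !inE /=.
by case: (col u) (col v) => [[|[|[|?]]] ?] [[|[|[|?]]] ?].
Qed.

Lemma ordS_cycle3 (i : 'I_3) : ordS (ordS (ordS i)) = i.
Proof. by apply/val_inj; case: i => [[|[|[|?]]] ?]. Qed.

Lemma ordS3_neq (i : 'I_3) : ordS i != i.
Proof. by case: i => [[|[|[|?]]] ?]. Qed.

(** A dominating set missing part [i] contains all of part [i + 1], whose
    vertices have in-arcs from part [i] only, and one vertex of
    part [i - 1 = i + 2] to dominate part [i]; one that misses no part has at
    least three vertices. *)
Lemma cyclic_dominating_card m (S : {set V}) :
  0 < m <= 2 -> (forall i, m <= #|part_set i|) ->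
  dominating cyclic_orientation S -> m < #|S|.
Proof.
move=> /andP[m_gt0 m_le2] le_m /dominatingP domS.
have [/existsP[i /eqP Si] | /existsPn meetS] :=
  boolP [exists i, S :&: part_set i == set0]; last first.
  have sub3 : [set: 'I_3] \subset col @: S.
    apply/subsetP => i _; have /set0Pn[v] := meetS i.
    by rewrite inE in_part_set => /andP[vS /eqP <-]; apply: imset_f.
  have := subset_leq_card sub3; rewrite cardsT card_ord => S3.
  exact: leq_ltn_trans m_le2 (leq_trans S3 (leq_imset_card _ _)).
have noS v : v \in S -> col v != i.
  move=> vS; apply/negP => vi; have : v \in S :&: part_set i.
    by rewrite inE vS in_part_set.
  by rewrite Si inE.
have ordS_inj : injective (@ordS 3).
  by apply: (can_inj (g := fun j => ordS (ordS j))) => j; exact: ordS_cycle3.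
have subS : part_set (ordS i) \subset S.
  apply/subsetP => v; rewrite in_part_set => /eqP vi.
  apply/negPn/negP => /domS[u uS].
  rewrite inE /= vi => /eqP /ordS_inj iu.
  by have := noS u uS; rewrite -iu eqxx.
have /card_gt0P[v] : 0 < #|part_set i| := leq_trans m_gt0 (le_m i).
rewrite in_part_set => /eqP vi.
have [u uS] : exists2 u, u \in S & (u, v) \in cyclic_orientation.
  by apply: domS; apply/negP => /noS; rewrite vi eqxx.
rewrite inE /= vi => /eqP iu.
have nu : u \notin part_set (ordS i).
  apply/negP; rewrite in_part_set => /eqP ui.
  have := ordS3_neq (ordS (ordS i)); rewrite ordS_cycle3 {1}iu ui eqxx //.
apply: leq_ltn_trans (le_m (ordS i)) _; apply/proper_card/properP; split=> //.
by exists u.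
Qed.

Lemma DOM_gt_cyclic m :
  0 < m <= 2 -> (forall i, m <= #|part_set i|) -> m < DOM multipartite.
Proof.
move=> hm le_m; apply: (DOM_ge cyclic_orientationP) => S.
exact: cyclic_dominating_card.
Qed.

End ThreeParts.

(** * The complete tripartite graph *)

Lemma ord3_cases (i : 'I_3) : [\/ i = inord 0, i = inord 1 | i = inord 2].
Proof.
case: i => [[|[|[|?]]] ?] //; [apply: Or31 | apply: Or32 | apply: Or33];
  by apply/val_inj; rewrite /= inordK.
Qed.

Lemma card_parts n1 n2 n3 (A := part_set (@part n1 n2 n3)) :
  [/\ #|A (inord 0)| = n1, #|A (inord 1)| = n2 & #|A (inord 2)| = n3].
Proof.
have E (a b : nat) : (inord a : 'I_3) = inord b -> (a < 3) && (b < 3) ==> (a == b).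
  move/(congr1 val) => ab; apply/implyP => /andP[? ?].
  by move: ab; rewrite /= !inordK // => ->.
split.
- rewrite -[RHS](card_ord n1).
  apply: (card_part_set (f := fun x => inl (inl x) : tripartite_vertex n1 n2 n3)).
  + by move=> x y [].
  + by [].
  + by case=> [[x|x]|x] /= /E // _; exists x.
- rewrite -[RHS](card_ord n2).
  apply: (card_part_set (f := fun x => inl (inr x) : tripartite_vertex n1 n2 n3)).
  + by move=> x y [].
  + by [].
  + by case=> [[x|x]|x] /= /E // _; exists x.
- rewrite -[RHS](card_ord n3).
  apply: (card_part_set (f := fun x => inr x : tripartite_vertex n1 n2 n3)).
  + by move=> x y [].
  + by [].
  + by case=> [[x|x]|x] /= /E // _; exists x.
Qed.

Theorem theorem5p5 (n1 n2 n3 : nat)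
    (h1 : 1 <= n1) (h12 : n1 <= n2) (h23 : n2 <= n3) :
  DOM (complete_tripartite n1 n2 n3) =
    if 3 <= n3 then n3
    else if [&& n1 == 2, n2 == 2 & n3 == 2] then 3
    else 2.
Proof.
rewrite -[complete_tripartite _ _ _]/(multipartite (@part n1 n2 n3)).
have [c1 c2 c3] := card_parts n1 n2 n3.
have le_n3 i : #|part_set (@part n1 n2 n3) i| <= n3.
  by case: (ord3_cases i) => ->; rewrite ?c1 ?c2 ?c3 // (leq_trans h12).
have ge_n1 i : n1 <= #|part_set (@part n1 n2 n3) i|.
  by case: (ord3_cases i) => ->; rewrite ?c1 ?c2 ?c3 // (leq_trans h12).
have ge_n3 : n3 <= DOM (multipartite (@part n1 n2 n3)).
  have := DOM_ge_last (@part n1 n2 n3).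
  have <- : inord 2 = ord_max :> 'I_3 by apply/val_inj; rewrite /= inordK.
  by rewrite c3.
have up3 : DOM (multipartite (@part n1 n2 n3)) <= maxn n3 3.
  by apply: DOM_le => D orD; apply: (gamma_le_maxn3 orD).
have gt_n1 : n1 <= 2 -> n1 < DOM (multipartite (@part n1 n2 n3)).
  by move=> n1_le2; apply: DOM_gt_cyclic; rewrite ?h1.
have up2 : n1 = 1 -> DOM (multipartite (@part n1 n2 n3)) <= maxn n3 2.
  move=> n1E; apply: DOM_le => D orD.
  by apply: (gamma_le_maxn2 orD le_n3 (i := inord 0)); rewrite c1.
move: (DOM _) ge_n3 up3 gt_n1 up2 => d ge_n3 up3 gt_n1 up2.
case: ifP => n3_ge3; last case: ifP => eq222; lia.
Qed.
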